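(* Let $\nu>0$ and let $\{Y_t\}_{t\ge 1}$ be a $\beta$ARC model (as defined in the context) whose systematic component is $$\eta_t=g(\mu_t)=\alpha+\boldsymbol{x}_t'\boldsymbol{\beta}+h\big(T^{t-1}(U_0)\big),\qquad t\ge 1,$$ where $\{\boldsymbol{x}_t\}_{t\ge1}$ is a set of random $l$-dimensional covariates, $\alpha\in\mathbb{R}$, $\boldsymbol\beta\in\mathbb{R}^l$, $g,h:(0,1)\to\mathbb{R}$ are twice continuously differentiable one-to-one link functions, $T:[0,1]\to[0,1]$ is a Borel measurable map, and $U_0$ is a random variable such that, with probability $1$, $T^t(U_0)\in(0,1)$ for all $t\ge 0$. Then the bivariate process $\{(Y_t,\mu_t)\}_{t\ge1}$ is jointly (strictly) stationary if and only if $\{\mu_t\}_{t\ge1}$ is (strictly) stationary.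
   Context: $T^k$ denotes the $k$-fold composition of $T$ ($T^0$ is the identity). The $\beta$ARC model (without autoregressive terms): $\mu_t$ is a $(0,1)$-valued random variable determined by $g(\mu_t)=\eta_t$ as in the claim, and, conditionally on $\mathscr{F}_{t-1}$, the $\sigma$-field generated by $U_0,\boldsymbol{x}_1,\dots,\boldsymbol{x}_t,Y_1,\dots,Y_{t-1}$, the variable $Y_t$ has the beta density $$f(y;\mu_t,\nu\mid\mathscr{F}_{t-1})=\frac{\Gamma(\nu)}{\Gamma(\nu\mu_t)\Gamma(\nu(1-\mu_t))}\,y^{\nu\mu_t-1}(1-y)^{\nu(1-\mu_t)-1},\qquad 0<y<1,$$ so that $\mathbb{E}(Y_t\mid\mathscr{F}_{t-1})=\mu_t$. The covariates are exogenous, meaning that, conditionally on $(U_0,\{\boldsymbol{x}_s\}_{s\ge1})$, the variables $Y_1,Y_2,\dots$ are independent and each $Y_t$ has the beta density $y\mapsto\frac{\Gamma(\nu)}{\Gamma(\nu\mu_t)\Gamma(\nu(1-\mu_t))}\,y^{\nu\mu_t-1}(1-y)^{\nu(1-\mu_t)-1}$ on $0<y<1$. Strict stationarity means that all finite-dimensional distributions are invariant under time shifts $t\mapsto t+k$, $k\ge 1$. *)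

(* Defs.v *)
From HB Require Import structures.
From mathcomp Require Import all_boot all_order all_algebra.
From mathcomp Require Import all_classical all_reals all_analysis.

Set Implicit Arguments.
Unset Strict Implicit.
Unset Printing Implicit Defensive.

Import Order.TTheory GRing.Theory Num.Theory.
Import numFieldNormedType.Exports.

Local Open Scope classical_set_scope.
Local Open Scope ring_scope.

Section analysis.
Context {R : realType}.
Implicit Types (f : R -> R).

(* Only the values of f on ]0, 1[ matter: derivatives at interior points of
   this open interval are local. *)
Definition C2_unit_itv f : Prop :=
  [/\ {in `]0, 1[, forall x, derivable f x 1},
      {in `]0, 1[, forall x, derivable (derive1 f) x 1} &
      {in `]0, 1[, continuous (derive1 (derive1 f))}].

Definition Gamma (z : R) : R :=
  (\int[lebesgue_measure]_(s in `]0%R, +oo[) (s `^ (z - 1) * expR (- s)))%R.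

(* Mean-precision parametrization, i.e. Beta (nu * m, nu * (1 - m)); the library's
   beta_pdf only has natural number parameters. Meaningful for 0 < y < 1. *)
Definition beta_density (nu m y : R) : R :=
  Gamma nu / (Gamma (nu * m) * Gamma (nu * (1 - m)))
  * y `^ (nu * m - 1) * (1 - y) `^ (nu * (1 - m) - 1).

Definition beta_law (nu m : R) (B : set R) : R :=
  (\int[lebesgue_measure]_(y in B `&` `]0%R, 1%R[) beta_density nu m y)%R.

End analysis.

Section conditioning.
Context d (Omega : measurableType d) (R : realType) (P : probability Omega R).

(* G is meant to be a sub-sigma-algebra of the events of Omega. *)
Definition cond_prob_version (G : set (set Omega)) (A : set Omega)
    (p : Omega -> R) : Prop :=
  [/\ forall B : set R, measurable B -> G (p @^-1` B),
      P.-integrable setT (EFin \o p) &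
      forall E, G E -> (\int[P]_(w in E) (p w)%:E = P (A `&` E))%E].

(* P(A | G) = p almost surely *)
Definition cond_prob (G : set (set Omega)) (A : set Omega) (p : Omega -> R) :
    Prop :=
  exists2 p0, cond_prob_version G A p0 & {ae P, forall w, p w = p0 w}.

Definition cond_beta (G : set (set Omega)) (Y : Omega -> R) (nu : R)
    (m : Omega -> R) : Prop :=
  forall B : set R, measurable B ->
    cond_prob G (Y @^-1` B) (fun w => beta_law nu (m w) B).

(* Mutual independence of Y 1, Y 2, ... conditionally on G: the product rule
   for the conditional probabilities of every finite subfamily. *)
Definition cond_independent (G : set (set Omega)) (Y : nat -> Omega -> R) :
    Prop :=
  forall (s : seq nat), uniq s -> {in s, forall t, (1 <= t)%N} ->
  forall B : nat -> set R, (forall t, measurable (B t)) ->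
  forall p : nat -> Omega -> R,
    {in s, forall t, cond_prob G (Y t @^-1` B t) (p t)} ->
    cond_prob G (\bigcap_(t in [set` s]) (Y t @^-1` B t))
      (fun w => \prod_(t <- s) p t w).

Definition strictly_stationary d' (S : measurableType d')
    (X : nat -> Omega -> S) : Prop :=
  forall (k n : nat) (t : n.-tuple nat), (1 <= k)%N ->
    (forall i, (1 <= tnth t i)%N) ->
  forall A : set (n.-tuple S), measurable A ->
    P [set w | A [tuple X (tnth t i + k)%N w | i < n]] =
    P [set w | A [tuple X (tnth t i) w | i < n]].

End conditioning.

Section information.
Context d (Omega : measurableType d) (R : realType) (l : nat).
Variables (U0 : Omega -> R)
  (x : nat -> Omega -> l.-tuple (measurableTypeR R)) (Y : nat -> Omega -> R).

Let events d' (S : measurableType d') (Z : Omega -> S) : set (set Omega) :=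
  preimage_set_system setT Z measurable.

(* The information available just before Y_t is drawn, F_{t-1}. *)
Definition past_sigma (t : nat) : set (set Omega) :=
  <<s events (U0 : Omega -> measurableTypeR R)
      `|` \bigcup_(s in [set s | (1 <= s <= t)%N]) events (x s)
      `|` \bigcup_(s in [set s | (1 <= s < t)%N])
            events (Y s : Omega -> measurableTypeR R) >>.

Definition exogenous_sigma : set (set Omega) :=
  <<s events (U0 : Omega -> measurableTypeR R)
      `|` \bigcup_(s in [set s | (1 <= s)%N]) events (x s) >>.

End information.

Definition dotp (R : realType) (l : nat) (u v : l.-tuple R) : R :=
  \sum_(i < l) tnth u i * tnth v i.

(* Main.v *)
(* Conditionally on the sigma-algebra G of (U_0, x_1, x_2, ...), the Y_t are
   independent with the beta laws K(mu_t, .), and mu_t is G-measurable up to null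
   sets because g is continuous and injective, hence strictly monotone. Therefore,
   for distinct times t in s,
     P(Y_t in B_t and mu_t in C_t for all t in s)
       = E[prod_(t in s) K(mu_t, B_t) 1_(C_t)(mu_t)],
   which only depends on the joint law of (mu_t)_(t in s). When mu is stationary,
   (Y, mu) is thus stationary on rectangles, and these form a pi-system generating
   the product sigma-algebra. The converse is a projection. *)

Require Import Defs.
From mathcomp Require Import all_boot all_order all_algebra.
From mathcomp Require Import all_classical all_reals all_analysis.
From mathcomp Require Import measurable_realfun.

Set Implicit Arguments.
Unset Strict Implicit.
Unset Printing Implicit Defensive.

Import Order.TTheory GRing.Theory Num.Theory.
Import numFieldNormedType.Exports.

Local Open Scope classical_set_scope.
Local Open Scope ring_scope.


(** * Borel measurability of the beta law in its mean parameter *)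

Section measurability.
Context {R : realType}.

Lemma measurable_fun_powR2 d (T : measurableType d) (f g : T -> R) :
  measurable_fun setT f -> measurable_fun setT g ->
  measurable_fun setT (fun w => f w `^ g w).
Proof.
move=> mf mg; rewrite /powR; apply: measurable_fun_ifT.
- exact: measurable_fun_eqr.
(* At base 0, [powR] is 1 or 0 according to whether the exponent vanishes. *)
- rewrite (_ : (fun w => _) = fun w => if g w == 0 then 1 else 0); last first.
    by apply/funext => w; case: ifP.
  by apply: measurable_fun_ifT => //; exact: measurable_fun_eqr.
- apply: measurableT_comp => //; apply: measurable_funM => //.
  exact: measurableT_comp.
Qed.

(** This is Tonelli's theorem: the domain [D] is absorbed into the integrand as an indicator, and
    the extended-real integral is composed with the measurable map [fine], exactly as in the
    definition of the real-valued integral. *)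
Lemma measurable_param_Rintegral d1 d2 (T1 : measurableType d1)
    (T2 : measurableType d2) (m : {sigma_finite_measure set T2 -> \bar R})
    (D : set T2) (f : T1 -> T2 -> R) :
  measurable D -> measurable_fun setT (fun z : T1 * T2 => f z.1 z.2) ->
  (forall x y, 0 <= f x y) ->
  measurable_fun setT (fun x => (\int[m]_(y in D) f x y)%R).
Proof.
move=> mD mf f0.
pose F (z : T1 * T2) : \bar R := (f z.1 z.2 * \1_D z.2)%:E.
have mF : measurable_fun setT F.
  apply/measurable_EFinP; apply: measurable_funM => //.
  by apply: measurableT_comp => //; exact: measurable_indic.
have F0 z : (0 <= F z)%E by rewrite lee_fin mulr_ge0.
have mFx := measurable_fun_fubini_tonelli_F (m2 := m) F mF F0.
apply: (eq_measurable_fun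
  (fine \o fubini_F m F)) => [x _ /=|]; last first.
  by apply: measurableT_comp => //; exact: fine_measurable.
rewrite /Rintegral; congr fine; rewrite integral_mkcond.
apply: eq_integral => y _; rewrite /F /= patchE indicE.
by case: (y \in D); rewrite ?mulr1 ?mulr0.
Qed.

Lemma Gamma_ge0 (z : R) : 0 <= Gamma z.
Proof.
by apply: Rintegral_ge0 => s _; rewrite mulr_ge0// ?powR_ge0 ?expR_ge0.
Qed.

Lemma measurable_Gamma : measurable_fun setT (@Gamma R).
Proof.
apply: measurable_param_Rintegral => //.
- apply: measurable_funM.
  + apply: measurable_fun_powR2 => //.
    exact: measurable_funB.
  + by apply: measurableT_comp => //; exact: measurableT_comp.
- by move=> z s; rewrite mulr_ge0// ?powR_ge0 ?expR_ge0.
Qed.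

Lemma beta_density_ge0 (nu m y : R) : 0 <= beta_density nu m y.
Proof. by rewrite !mulr_ge0 ?powR_ge0 ?invr_ge0 ?mulr_ge0 ?Gamma_ge0. Qed.

Lemma beta_law_ge0 (nu m : R) (B : set R) : 0 <= beta_law nu m B.
Proof. by apply: Rintegral_ge0 => y _; exact: beta_density_ge0. Qed.

(** This makes the conditional probability of [Y t] falling in [B] a Borel function of [mu t], whose
    expectation is then governed by the law of [mu]. *)
Lemma measurable_beta_law (nu : R) (B : set R) :
  measurable B -> measurable_fun setT (fun m : R => beta_law nu m B).
Proof.
move=> mB; apply: measurable_param_Rintegral => //.
- exact: measurableI.
- have m1 : measurable_fun setT (fun z : R * R => nu * z.1).
    exact: measurable_funM.
  have m2 : measurable_fun setT (fun z : R * R => nu * (1 - z.1)).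
    by apply: measurable_funM => //; exact: measurable_funB.
  apply: measurable_funM; first apply: measurable_funM;
    first apply: measurable_funM => //.
  (* The reciprocal becomes a power with exponent -1, legitimate for a nonnegative base; both
     conventions give 0 at 0. *)
  + rewrite (_ : (fun z => _) = fun z : R * R =>
        (Gamma (nu * z.1) * Gamma (nu * (1 - z.1))) `^ (- 1)); last first.
      by apply/funext => z; rewrite powR_inv1// mulr_ge0 ?Gamma_ge0.
    apply: measurable_fun_powR2 => //.
    by apply: measurable_funM; exact: (measurableT_comp measurable_Gamma).
  + apply: measurable_fun_powR2 => //; exact: measurable_funB.
  + by apply: measurable_fun_powR2; exact: measurable_funB.
- by move=> m y; exact: beta_density_ge0.
Qed.
End measurability.

(** * Recovering the events of the mean from the linear predictor *)

Section link_function.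
Context {R : realType}.

Lemma C2_unit_itv_continuous (f : R -> R) : C2_unit_itv f ->
  {within [set` `]0, 1[], continuous f}.
Proof.
move=> [df _ _]; apply: continuous_in_subspaceT => x; rewrite inE/= => x01.
by apply/differentiable_continuous/derivable1_diffP/df.
Qed.

Lemma measurable_patch_unit_itv (f : R -> R) : C2_unit_itv f ->
  measurable_fun setT (f \_ `]0, 1[).
Proof.
move=> /C2_unit_itv_continuous cf.
apply: (measurable_restrictT f _).1 => //.
exact: subspace_continuous_measurable_fun.
Qed.

Lemma measurable_gen d (T : pointedType) (S : measurableType d)
    (G : set (set T)) (Z : T -> S) :
  preimage_set_system setT Z measurable `<=` G ->
  measurable_fun [set: g_sigma_algebraType G] (Z : g_sigma_algebraType G -> S).
Proof.
move=> ZG _ B mB; apply: sub_gen_smallest; apply: ZG.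
by exists B.
Qed.

(** The sets [C] whose preimage under [m] is almost surely an event of [<<s G >>] form a
    sigma-algebra, so rays suffice. On a ray, monotonicity of [g] turns a bound on [m] into a bound
    on [eta]; no measurable inverse of [g] has to be built. *)
Lemma ae_preimage_link d (Omega : measurableType d) (P : probability Omega R)
    (G : set (set Omega)) (g : R -> R) (eta m : Omega -> R) :
  {within [set` `]0, 1[], continuous g} -> {in `]0, 1[ &, injective g} ->
  measurable_fun [set: g_sigma_algebraType G]
    (eta : g_sigma_algebraType G -> R) ->
  (forall w, m w \in `]0, 1[) -> {ae P, forall w, g (m w) = eta w} ->
  forall C : set R, measurable C ->
  exists2 E, <<s G >> E & {ae P, forall w, E w <-> C (m w)}.
Proof.
move=> cg ig meta m01 gm C mC.
pose S : set (set R) :=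
  [set C | exists2 E, <<s G >> E & {ae P, forall w, E w <-> C (m w)}].
have : <<s @RGenCInfty.G R >> C.
  have := mC; rewrite /measurable/=.
  by move: (RGenCInfty.measurableE R); rewrite /measurable/= => <-.
suff: <<s @RGenCInfty.G R >> `<=` S by apply.
apply: smallest_sub.
  split.
  - exists set0; first exact: sigma_algebra0.
    exact: aeW.
  - move=> A [E GE EA]; exists (setT `\` E).
      exact: sigma_algebraCD.
    apply: filterS EA => w EA.
    by split=> -[_ NA]; split => // /EA.
  - move=> A SA.
    have /choice[E GE] : forall n, exists E, <<s G >> E /\
        {ae P, forall w, E w <-> A n (m w)}.
      by move=> n; have [E ? ?] := SA n; exists E.
    exists (\bigcup_k E k).
      by apply: sigma_algebra_bigcup => n; have [] := GE n.
    (* Countably many exceptional null sets are merged into one. *)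
    have : {ae P, forall w, forall n, E n w <-> A n (m w)}.
      by apply: ae_foralln => n; exact: (GE n).2.
    apply: filterS => w EA.
    by split=> -[n _ /EA]; exists n.
move=> _ [c ->].
(* [g] is controlled only on the open unit interval. A ray starting at [c <= 0] contains all values
   of [m], and one starting at [c >= 1] contains none. *)
have [c0|c0] := leP c 0.
  exists setT; first exact: (@measurableT _ (g_sigma_algebraType G)).
  apply: aeW => w /=; split => // _.
  by have := m01 w; rewrite !in_itv/= andbT => /andP[/ltW + _]; exact: le_trans.
have [c1|c1] := leP 1 c.
  exists set0; first exact: sigma_algebra0.
  apply: aeW => w /=; split => //.
  have := m01 w; rewrite !in_itv/= andbT => /andP[_ m1] cm.
  by have := lt_le_trans m1 (le_trans c1 cm); rewrite ltxx.
have c01 : c \in `]0, 1[ by rewrite in_itv/= c0.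
(* For increasing [g], [c <= m w] means [g c <= eta w] almost surely; for decreasing [g] the
   inequality is reversed. *)
have [/le_mono_in gle|/le_nmono_in gle] := itv_continuous_inj_mono cg ig.
- exists [set w | g c <= eta w].
    have := measurable_fun_ler (measurable_cst (g c)) meta.
    move=> /(_ (@measurableT _ (g_sigma_algebraType G)) [set true] I).
    by rewrite setTI; exact.
  apply: filterS gm => w gm /=.
  by rewrite -gm in_itv/= andbT gle//.
- exists [set w | eta w <= g c].
    have := measurable_fun_ler meta (measurable_cst (g c)).
    move=> /(_ (@measurableT _ (g_sigma_algebraType G)) [set true] I).
    by rewrite setTI; exact.
  apply: filterS gm => w gm /=.
  by rewrite -gm in_itv/= andbT gle//.
Qed.

End link_function.

(** * Conditional probabilities and null sets *)

Section conditional_probability.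
Context d (Omega : measurableType d) (R : realType) (P : probability Omega R).

Lemma ae_eq_set_integral (E F : set Omega) (p : Omega -> \bar R) :
  measurable E -> measurable F -> measurable_fun setT p ->
  {ae P, forall w, E w <-> F w} ->
  (\int[P]_(w in E) p w = \int[P]_(w in F) p w)%E.
Proof.
move=> mE mF mp EF; rewrite integral_mkcond [RHS]integral_mkcond.
apply: ae_eq_integral => //.
- by apply: (measurable_restrictT p mE).1; exact: measurable_funTS.
- by apply: (measurable_restrictT p mF).1; exact: measurable_funTS.
- apply: filterS EF => w EF _; rewrite !patchE.
  by have -> : (w \in E) = (w \in F) by apply/idP/idP; rewrite !inE => /EF.
Qed.

(** The defining identity of conditional probability survives changes on null sets, both of the
    event of [G] and of the version [p]. This is needed because the events of [mu] belong to the
    exogenous sigma-algebra only up to null sets. *)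
Lemma cond_prob_ae_setI (G : set (set Omega)) (A E F : set Omega)
    (p : Omega -> R) :
  G `<=` measurable -> measurable A -> measurable F -> measurable_fun setT p ->
  cond_prob P G A p -> G E -> {ae P, forall w, E w <-> F w} ->
  (P (A `&` F) = \int[P]_(w in F) (p w)%:E)%E.
Proof.
move=> Gm mA mF mp [p0 [_ ip0 p0E] pp0] GE EF.
have mE := Gm _ GE.
have -> : P (A `&` F) = P (A `&` E).
  (* Both probabilities are read as integrals of the constant 1. *)
  rewrite -[LHS]mul1e -[RHS]mul1e -!integral_cst//; [|exact: measurableI..].
  apply: ae_eq_set_integral => //; [exact: measurableI..|].
  by apply: filterS EF => w EF; split=> -[Aw /EF].
have mp0 : measurable_fun setT (EFin \o p0) := measurable_int P ip0.
rewrite -p0E// (ae_eq_set_integral (F := F))//.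
apply: ae_eq_integral => //.
- exact: measurable_funTS.
- exact/measurable_EFinP/measurable_funTS.
- by apply: filterS pp0 => w ->.
Qed.

End conditional_probability.

(** * Joint probabilities of rectangles, and integrals under stationarity *)

Section stationarity.
Context d (Omega : measurableType d) (R : realType) (P : probability Omega R).

Lemma ae_all_in (s : seq nat) (Q : nat -> Omega -> Prop) :
  (forall t, t \in s -> {ae P, forall w, Q t w}) ->
  {ae P, forall w, forall t, t \in s -> Q t w}.
Proof.
move=> sQ; apply: ae_foralln => t; have [/sQ|_] := boolP (t \in s).
  by apply: filterS.
exact: aeW.
Qed.

Lemma g_sigma_algebra_setI_seq (T : pointedType) (G : set (set T)) (s : seq nat)
    (E : nat -> set T) :
  (forall t, t \in s -> <<s G >> (E t)) ->
  <<s G >> [set w | forall t, t \in s -> E t w].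
Proof.
move=> GE.
rewrite (_ : [set w | _] = \bigcap_(t in [set` s]) E t)//.
exact: (@fin_bigcap_measurable _ (g_sigma_algebraType G)).
Qed.

Lemma measurable_setI_seq d' (T : measurableType d') (s : seq nat)
    (E : nat -> set T) :
  (forall t, t \in s -> measurable (E t)) ->
  measurable [set w | forall t, t \in s -> E t w].
Proof.
move=> mE.
rewrite (_ : [set w | _] = \bigcap_(t in [set` s]) E t)//.
exact: fin_bigcap_measurable.
Qed.

(** Conditional independence gives the product of the beta laws as conditional probability of the
    [Y] part, which is then integrated over the [mu] part. The right-hand side involves [mu]
    alone. *)
Lemma beta_joint_probability (G : set (set Omega)) (nu : R)
    (Y mu : nat -> {RV P >-> R}) (s : seq nat) (B C : nat -> set R) :
  <<s G >> `<=` measurable ->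
  (forall t, (1 <= t)%N -> forall D : set R, measurable D ->
    exists2 E, <<s G >> E & {ae P, forall w, E w <-> D (mu t w)}) ->
  cond_independent P <<s G >> (fun t => Y t) ->
  (forall t, (1 <= t)%N -> cond_beta P <<s G >> (Y t) nu (mu t)) ->
  uniq s -> {in s, forall t, (1 <= t)%N} ->
  (forall t, measurable (B t)) -> (forall t, measurable (C t)) ->
  P [set w | forall t, t \in s -> B t (Y t w) /\ C t (mu t w)] =
  (\int[P]_w (\prod_(t <- s) (beta_law nu (mu t w) (B t) * \1_(C t) (mu t w)))%:E)%E.
Proof.
move=> Gm Gmu indepY betaY us s1 mB mC.
pose p t w := beta_law nu (mu t w) (B t).
have mp t : measurable_fun setT (p t).
  exact: (measurableT_comp (measurable_beta_law _ (mB t))).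
pose A := \bigcap_(t in [set` s]) (Y t @^-1` B t).
pose F := [set w | forall t, t \in s -> C t (mu t w)].
have /choice[E GE] : forall t, exists E, t \in s -> <<s G >> E /\
    {ae P, forall w, E w <-> C t (mu t w)}.
  move=> t; have [ts|_] := boolP (t \in s); last by exists set0.
  by have [E ? ?] := Gmu _ (s1 _ ts) _ (mC t); exists E.
have mF : measurable F.
  apply: measurable_setI_seq => t _; rewrite -[X in measurable X]setTI.
  exact: measurable_funP.
have mA : measurable A.
  apply: fin_bigcap_measurable => // t _; rewrite -[X in measurable X]setTI.
  exact: measurable_funP.
have mprod : measurable_fun setT (fun w => \prod_(t <- s) p t w).
  by apply: measurable_prod.
rewrite (_ : [set w | _] = A `&` F); last first.
  apply/seteqP; split => [w BC|w [Aw Fw] t ts].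
    by split => t ts; have [] := BC _ ts.
  by split; [exact: Aw|exact: Fw].
rewrite (@cond_prob_ae_setI _ _ _ _ <<s G >> A
    [set w | forall t, t \in s -> E t w] F (fun w => \prod_(t <- s) p t w))//.
(* The indicator of [F] is the product of the indicators of the [C t]: outside [F] some factor is
   0. *)
- rewrite integral_mkcond; apply: eq_integral => w _.
  rewrite patchE big_split/=; case: ifPn => [|Fw].
    rewrite inE => Fw; rewrite [X in _ * X]big1_seq ?mulr1// => t /andP[_ ts].
    by rewrite indicE mem_set//; exact: Fw.
  suff -> : \prod_(t <- s) (\1_(C t) (mu t w) : R) = 0 by rewrite mulr0.
  apply/eqP; rewrite prodf_seq_eq0; apply: contraNT Fw => /hasPn/= sC.
  rewrite inE => t ts; have := sC _ ts; rewrite indicE pnatr_eq0 eqb0 negbK.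
  by rewrite inE.
- by apply: indepY => // t ts; apply: betaY => //; exact: s1.
- by apply: g_sigma_algebra_setI_seq => t /GE[].
- have : {ae P, forall w, forall t, t \in s -> (E t w <-> C t (mu t w))}.
    by apply: ae_all_in => t /GE[].
  apply: filterS => w EC; split=> + t ts => /(_ _ ts); by move/(EC t ts).
Qed.

(** Stationarity says that the shifted and unshifted tuples have the same image measure; the claim
    follows by change of variables. *)
Lemma strictly_stationary_integral d' (S : measurableType d')
    (X : nat -> Omega -> S) (k n : nat) (t : n.-tuple nat)
    (F : n.-tuple S -> \bar R) :
  (forall t, measurable_fun setT (X t)) -> strictly_stationary P X ->
  (1 <= k)%N -> (forall i, (1 <= tnth t i)%N) ->
  measurable_fun setT F -> (forall u, 0 <= F u)%E ->
  (\int[P]_w F [tuple X (tnth t i + k)%N w | i < n] =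
   \int[P]_w F [tuple X (tnth t i) w | i < n])%E.
Proof.
move=> mX statX k1 t1 mF F0.
have mtX (a : 'I_n -> nat) :
    measurable_fun setT (fun w => [tuple X (a i) w | i < n]).
  apply/measurable_fun_tnthP => i.
  by apply: eq_measurable_fun (mX (a i)) => w _ /=; rewrite tnth_mktuple.
rewrite -(@ge0_integral_pushforward _ _ _ _ _ _ (mtX _) P setT F)//.
rewrite -(@ge0_integral_pushforward _ _ _ _ _ _ (mtX _) P setT F)//.
by apply: eq_measure_integral => A mA _; exact: statX.
Qed.

Lemma strictly_stationary_integral_prod d' (S : measurableType d')
    (X : nat -> Omega -> S) (k : nat) (s : seq nat) (f : nat -> S -> R) :
  (forall t, measurable_fun setT (X t)) -> strictly_stationary P X ->
  (1 <= k)%N -> {in s, forall t, (1 <= t)%N} ->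
  (forall t, measurable_fun setT (f t)) -> (forall t x, 0 <= f t x) ->
  (\int[P]_w (\prod_(t <- s) f t (X (t + k)%N w))%:E =
   \int[P]_w (\prod_(t <- s) f t (X t w))%:E)%E.
Proof.
move=> mX statX k1 s1 mf f0.
(* The product over times is a function of the tuple of values, indexed by positions in [s]. *)
pose F (u : (size s).-tuple S) : \bar R :=
  (\prod_(i < size s) f (tnth (in_tuple s) i) (tnth u i))%:E.
have -> : (\int[P]_w (\prod_(t <- s) f t (X t w))%:E =
    \int[P]_w F [tuple X (tnth (in_tuple s) i) w | i < size s])%E.
  apply: eq_integral => w _; rewrite /F big_tnth.
  by congr EFin; apply: eq_bigr => i _; rewrite tnth_mktuple.
rewrite -(@strictly_stationary_integral _ _ _ k _ _ F)//.
- apply: eq_integral => w _; rewrite /F big_tnth.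
  by congr EFin; apply: eq_bigr => i _; rewrite tnth_mktuple.
- by move=> i; apply: s1; exact: mem_tnth.
- apply/measurable_EFinP; apply: measurable_prod => i _.
  by apply: measurableT_comp => //; exact: measurable_tnth.
- by move=> u; rewrite lee_fin prodr_ge0.
Qed.

End stationarity.

(** * A generating pi-system for tuples of pairs *)

Section rectangles.
Context d1 d2 (T1 : measurableType d1) (T2 : measurableType d2) (n : nat).

(** Each pair is constrained by a product of two sides, matching the events on which [Y] and [mu]
    separate. *)
Definition tuple_rectangles : set (set (n.-tuple (T1 * T2))) :=
  [set A | exists B : 'I_n -> set T1 * set T2,
    (forall i, measurable (B i).1 /\ measurable (B i).2) /\
    A = [set u | forall i, (B i).1 (tnth u i).1 /\ (B i).2 (tnth u i).2]].

Lemma tuple_rectangles_measurable : tuple_rectangles `<=` measurable.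
Proof.
move=> _ [B [mB ->]].
rewrite (_ : [set u | _] = \bigcap_(i in [set: 'I_n])
    (@tnth _ _ ^~ i @^-1` ((B i).1 `*` (B i).2))); last first.
  by apply/seteqP; split => u Bu i => [_|]; [exact: Bu|exact: (Bu i)].
apply: fin_bigcap_measurable => // i _; rewrite -[X in measurable X]setTI.
by apply: measurable_tnth => //; apply: measurableX; have [] := mB i.
Qed.

Lemma tuple_rectangles_setI_closed : setI_closed tuple_rectangles.
Proof.
move=> _ _ [B [mB ->]] [C [mC ->]].
exists (fun i => ((B i).1 `&` (C i).1, (B i).2 `&` (C i).2)); split.
  move=> i; have [mB1 mB2] := mB i; have [mC1 mC2] := mC i.
  by split; exact: measurableI.
apply/seteqP; split => u /=.
  by move=> [Bu Cu] i; have [? ?] := Bu i; have [? ?] := Cu i.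
by move=> BCu; split=> i; have [[? ?] [? ?]] := BCu i.
Qed.

Lemma tuple_rectanglesT : tuple_rectangles setT.
Proof.
exists (fun=> (setT, setT)); split=> [i|]; first by split; exact: measurableT.
by apply/seteqP; split.
Qed.

(** Rectangles generate because a constraint on one component of one coordinate is already a
    rectangle, with all other sides full; hence the identity map is measurable from the generated
    sigma-algebra. *)
Lemma measurable_tuple_rectangles :
  @measurable _ (n.-tuple (T1 * T2)) = <<s tuple_rectangles >>.
Proof.
apply/seteqP; split; last first.
  apply: smallest_sub; first exact: sigma_algebra_measurable.
  exact: tuple_rectangles_measurable.
have mid : measurable_fun setT
    (id : g_sigma_algebraType tuple_rectangles -> n.-tuple (T1 * T2)).
  apply/measurable_fun_tnthP => i; apply/measurable_fun_pairP; split.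
    move=> _ B mB; rewrite setTI; apply: sub_gen_smallest.
    exists (fun j => (if j == i then B else setT, setT)); split.
      by move=> j /=; split; [case: ifP => _ //|]; exact: measurableT.
    apply/seteqP; split => u /=.
      by move=> Bu j; case: eqP => // ->.
    by move=> /(_ i); rewrite eqxx => -[].
  move=> _ B mB; rewrite setTI; apply: sub_gen_smallest.
  exists (fun j => (setT, if j == i then B else setT)); split.
    by move=> j /=; split; [|case: ifP => _ //]; exact: measurableT.
  apply/seteqP; split => u /=.
    by move=> Bu j; case: eqP => // ->.
  by move=> /(_ i); rewrite eqxx => -[].
by move=> A mA; have := mid measurableT A mA; rewrite setTI.
Qed.

End rectangles.

(** * Transfer of stationarity between the pair process and its components *)

Section pair_process.
Context d (Omega : measurableType d) (R : realType) (P : probability Omega R).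

(** An event on the image process is the preimage, under [f] applied coordinatewise, of an event on
    [X]. *)
Lemma strictly_stationary_comp d1 d2 (S1 : measurableType d1)
    (S2 : measurableType d2) (f : S1 -> S2) (X : nat -> Omega -> S1) :
  measurable_fun setT f -> strictly_stationary P X ->
  strictly_stationary P (fun t w => f (X t w)).
Proof.
move=> mf statX k n t k1 t1 A mA.
pose ff (u : n.-tuple S1) := [tuple f (tnth u i) | i < n].
have mff : measurable_fun setT ff.
  apply/measurable_fun_tnthP => i.
  apply: (eq_measurable_fun (f \o (@tnth _ _ ^~ i))) => [u _ /=|].
    by rewrite tnth_mktuple.
  by apply: measurableT_comp => //; exact: measurable_tnth.
have := statX k n t k1 t1 (ff @^-1` A).
rewrite -[ff @^-1` A]setTI => /(_ (mff measurableT _ mA)); rewrite setTI.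
have E (a : 'I_n -> nat) w :
    ff [tuple X (a i) w | i < n] = [tuple f (X (a i) w) | i < n].
  by apply: eq_from_tnth => i; rewrite !tnth_mktuple.
rewrite [X in P X = _ -> _](_ : _ =
    [set w | A [tuple f (X (tnth t i + k)%N w) | i < n]]); last first.
  by apply/funext => w /=; rewrite E.
rewrite [X in _ = P X -> _](_ : _ =
    [set w | A [tuple f (X (tnth t i) w) | i < n]])//.
by apply/funext => w /=; rewrite E.
Qed.

(** Two probability laws agreeing on a generating pi-system coincide. The hypothesis concerns
    distinct times only, the form in which conditional independence is available. *)
Lemma strictly_stationary_rectangles d1 d2 (T1 : measurableType d1)
    (T2 : measurableType d2) (X : nat -> Omega -> T1) (Z : nat -> Omega -> T2) :
  (forall t, measurable_fun setT (X t)) ->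
  (forall t, measurable_fun setT (Z t)) ->
  (forall k (s : seq nat) (B : nat -> set T1) (C : nat -> set T2),
    (1 <= k)%N -> uniq s -> {in s, forall t, (1 <= t)%N} ->
    (forall t, measurable (B t)) -> (forall t, measurable (C t)) ->
    P [set w | forall t, t \in s -> B t (X (t + k)%N w) /\ C t (Z (t + k)%N w)] =
    P [set w | forall t, t \in s -> B t (X t w) /\ C t (Z t w)]) ->
  strictly_stationary P (fun t w => (X t w, Z t w)).
Proof.
move=> mX mZ XZ k n t k1 t1 A mA.
have mXZ (a : 'I_n -> nat) :
    measurable_fun setT (fun w => [tuple (X (a i) w, Z (a i) w) | i < n]).
  apply/measurable_fun_tnthP => i.
  apply: (eq_measurable_fun (fun w => (X (a i) w, Z (a i) w))) => [w _ /=|].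
    by rewrite tnth_mktuple.
  exact: measurable_fun_pair.
pose m (a : 'I_n -> nat) := distribution P (mfun_Sub (mem_set (mXZ a))).
suff: m (fun i => tnth t i + k)%N A = m (tnth t) A by [].
(* The laws being finite, the constant sequence [setT] serves as exhaustion. *)
apply: (measure_unique (@tuple_rectangles _ _ T1 T2 n) (fun=> setT)) => //.
- exact: measurable_tuple_rectangles.
- exact: tuple_rectangles_setI_closed.
- by move=> _; exact: tuple_rectanglesT.
- by rewrite bigcup_const.
- move=> _ [B [mB ->]].
  (* A time occurring several times in t is merged by intersecting its
     constraints, so that XZ only has to deal with distinct times. *)
  pose B1 j := \bigcap_(i in [set i | tnth t i = j]) (B i).1.
  pose B2 j := \bigcap_(i in [set i | tnth t i = j]) (B i).2.
  have BE (h : nat -> nat) :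
    [set w | forall i, (B i).1 (X (h (tnth t i)) w) /\
                       (B i).2 (Z (h (tnth t i)) w)] =
    [set w | forall j, j \in undup t -> B1 j (X (h j) w) /\ B2 j (Z (h j) w)].
    apply/seteqP; split => w /= Bw.
      move=> j _; split=> i /= <-; by have [] := Bw i.
    by move=> i; have := Bw (tnth t i); rewrite mem_undup mem_tnth;
      move=> -[//|B1w B2w];
      split; [exact: B1w|exact: B2w].
  have mE (a : 'I_n -> nat) : m a
      [set u | forall i, (B i).1 (tnth u i).1 /\ (B i).2 (tnth u i).2] =
      P [set w | forall i, (B i).1 (X (a i) w) /\ (B i).2 (Z (a i) w)].
    congr (P _); apply/seteqP; split => w /= + i => /(_ i);
      by rewrite tnth_mktuple.
  apply: etrans (mE _) _; apply: etrans _ (esym (mE _)).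
  rewrite (BE (addn^~ k)) (BE id); apply: XZ => //.
  + exact: undup_uniq.
  + by move=> j; rewrite mem_undup => /tnthP[i ->].
  + by move=> j; apply: fin_bigcap_measurable => // i _; have [] := mB i.
  + by move=> j; apply: fin_bigcap_measurable => // i _; have [] := mB i.
- by move=> _; rewrite (le_lt_trans (probability_le1 _ _))// ltry.
Qed.
End pair_process.

(** * Application to the model with chaotic component *)

Lemma exogenous_sigma_measurable d (Omega : measurableType d) (R : realType)
    (P : probability Omega R) (l : nat) (U0 : {RV P >-> R})
    (x : nat -> {RV P >-> l.-tuple (measurableTypeR R)}) :
  exogenous_sigma U0 (fun s => x s) `<=` measurable.
Proof.
apply: smallest_sub; first exact: sigma_algebra_measurable.
by move=> _ [[B mB <-]|[s _ [B mB <-]]]; exact: measurable_funP.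
Qed.

(** The predictor is a measurable function of [U0] and [x t], so the link argument applies to it. *)
Lemma ae_preimage_mu d (Omega : measurableType d) (R : realType)
    (P : probability Omega R) (l : nat) (alpha : R) (beta : l.-tuple R)
    (g h T : R -> R) (U0 : {RV P >-> R})
    (x : nat -> {RV P >-> l.-tuple (measurableTypeR R)})
    (t : nat) (mu : Omega -> R) :
  C2_unit_itv g -> {in `]0, 1[ &, injective g} -> C2_unit_itv h ->
  measurable_fun (`[0, 1] : set R) T ->
  {ae P, forall w, forall t : nat, iter t T (U0 w) \in `]0, 1[} ->
  (1 <= t)%N -> (forall w, mu w \in `]0, 1[) ->
  {ae P, forall w,
    g (mu w) = alpha + dotp (x t w) beta + h (iter t.-1 T (U0 w))} ->
  forall C : set R, measurable C ->
  exists2 E, exogenous_sigma U0 (fun s => x s) E &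
    {ae P, forall w, E w <-> C (mu w)}.
Proof.
move=> Cg ig Ch mT U01 t1 mu01 gmu.
(* T and h are only controlled on the unit interval; extended by 0 they are
   Borel on the whole line, and eta is unchanged almost surely. *)
pose T' := T \_ `[0, 1]; pose h' := h \_ `]0, 1[.
have mT' : measurable_fun setT T' by exact: (measurable_restrictT T _).1.
pose eta w := alpha + dotp (x t w) beta + h' (iter t.-1 T' (U0 w)).
rewrite /exogenous_sigma; set G := (X in <<s X >>).
have mU0 : measurable_fun [set: g_sigma_algebraType G]
    (U0 : g_sigma_algebraType G -> R).
  by apply: measurable_gen => A UA; left.
have mx : measurable_fun [set: g_sigma_algebraType G]
    (x t : g_sigma_algebraType G -> l.-tuple (measurableTypeR R)).
  by apply: measurable_gen => A xA; right; exists t.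
apply: (@ae_preimage_link _ _ _ P G g eta mu) => //.
- exact: C2_unit_itv_continuous.
- apply: measurable_funD.
    apply: measurable_funD => //; apply: measurable_sum => i.
    apply: measurable_funM => //.
    apply: (measurableT_comp (measurable_tnth i) mx).
  apply: (measurableT_comp (measurable_patch_unit_itv Ch)).
  by elim: t.-1 => [|n IH] /=; [exact: mU0|exact: measurableT_comp].
(* Almost surely the orbit stays in the open unit interval, where the extensions agree with [T] and
   [h]. *)
- apply: filterS2 U01 gmu => w U01 ->.
  have iterE n : iter n T' (U0 w) = iter n T (U0 w).
    elim: n => //= n ->; rewrite /T' patchE mem_set//=.
    exact: subset_itv_oo_cc (U01 n).
  by rewrite /eta iterE /h' patchE mem_set//; exact: U01.
Qed.

Theorem theorem2p1 (R : realType) (d : measure_display)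
    (Omega : measurableType d) (P : probability Omega R)
    (l : nat) (nu alpha : R) (beta : l.-tuple R) (g h T : R -> R)
    (U0 : {RV P >-> R}) (x : nat -> {RV P >-> l.-tuple (measurableTypeR R)})
    (Y mu : nat -> {RV P >-> R}) :
  0 < nu ->
  C2_unit_itv g -> {in `]0, 1[ &, injective g} ->
  C2_unit_itv h -> {in `]0, 1[ &, injective h} ->
  (forall u, u \in `[0, 1] -> T u \in `[0, 1]) ->
  measurable_fun (`[0, 1] : set R) T ->
  {ae P, forall w, forall t : nat, iter t T (U0 w) \in `]0, 1[} ->
  (forall t, (1 <= t)%N -> forall w, mu t w \in `]0, 1[) ->
  (forall t, (1 <= t)%N ->
    {ae P, forall w,
      g (mu t w) = alpha + dotp (x t w) beta + h (iter t.-1 T (U0 w))}) ->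
  (forall t, (1 <= t)%N ->
    cond_beta P (past_sigma U0 (fun s => x s) (fun s => Y s) t)
      (Y t) nu (mu t)) ->
  cond_independent P (exogenous_sigma U0 (fun s => x s)) (fun s => Y s) ->
  (forall t, (1 <= t)%N ->
    cond_beta P (exogenous_sigma U0 (fun s => x s)) (Y t) nu (mu t)) ->
  strictly_stationary P
    (fun t w => (Y t w, mu t w) : measurableTypeR R * measurableTypeR R) <->
  strictly_stationary P (fun t w => mu t w : measurableTypeR R).
Proof.
move=> _ Cg ig Ch _ _ mT U01 mu01 gmu _ indepY betaY; split.
  exact: strictly_stationary_comp measurable_snd.
move=> statmu.
apply: strictly_stationary_rectangles => [t|t|k s B C k1 us s1 mB mC];
  [exact: (@measurable_funPT _ _ _ _ (Y t))
  |exact: (@measurable_funPT _ _ _ _ (mu t))|].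
have Gmu t : (1 <= t)%N -> forall D : set R, measurable D ->
    exists2 E, exogenous_sigma U0 (fun s => x s) E &
      {ae P, forall w, E w <-> D (mu t w)}.
  move=> t1; exact: (ae_preimage_mu Cg ig Ch mT U01 t1 (mu01 t t1) (gmu t t1)).
have rect s' B' C' := beta_joint_probability (s := s') (B := B') (C := C')
  (exogenous_sigma_measurable (P := P) (U0 := U0) (x := x)) Gmu indepY betaY.
rewrite [RHS]rect//.
(* The shift is moved from the process to the list of times, so that [rect] applies. The truncated
   subtraction [t - k] is exact on these times. *)
transitivity (P [set w | forall t, t \in [seq (t + k)%N | t <- s] ->
    B (t - k)%N (Y t w) /\ C (t - k)%N (mu t w)]).
  congr (P _); apply/seteqP; split => w /= BC t.
    by move=> /mapP[{}t ts ->]; rewrite addnK; exact: BC.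
  by move=> ts; have := BC _ (map_f (addn^~ k) ts); rewrite addnK.
rewrite (rect _ (fun t => B (t - k)%N) (fun t => C (t - k)%N))//; [
  |by rewrite map_inj_uniq//; exact: addIn
  |by move=> _ /mapP[t ts ->]; rewrite ltn_addr// s1
  |by move=> t; exact: mB|by move=> t; exact: mC].
under eq_integral do rewrite big_map; under eq_integral do
  under eq_bigr do rewrite addnK.
(* Both sides now integrate the same product of functions of [mu], at shifted and at original
   times. *)
apply: (strictly_stationary_integral_prod (X := fun t w => mu t w)
  (f := fun t m => beta_law nu m (B t) * \1_(C t) m)) => //.
- move=> t; apply: measurable_funM; first exact: measurable_beta_law (mB t).
  exact: measurable_indic (mC t).
- by move=> t m; rewrite mulr_ge0 ?beta_law_ge0// indicE.
Qed.
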